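(* Let $K$ be a field, $R=K[x_1,\ldots,x_n]$ with a term order $<$, $F=(f_1,\ldots,f_m)$ a tuple of non-zero elements of $R$, and $I=\langle F\rangle$. The following are equivalent. (a) The tuple $F=(f_1,\ldots,f_m)$ is a Gröbner basis. (b) For any S-pair $p$ of $F$, the guessed signature $\hat S(p)$ is not the signature $S(\mathrm{Spoly}(p))$ (i.e. either $\mathrm{Spoly}(p)=0$, or $\hat S(p)\neq S(\mathrm{Spoly}(p))$). (c) For any standard S-pair $p$ of $F$, the guessed signature $\hat S(p)$ is not the signature $S(\mathrm{Spoly}(p))$ (in the same sense). (d) The equality $\mathrm{LM}(\mathrm{Syz}(F))=\mathrm{LM}(\mathrm{Syz}(\mathrm{LM}(F)))$ holds. (e) For any non-zero element $f\in I$, one has $\mathrm{LM}\left(\overline{S(f)}\right)=\mathrm{LM}(f)$.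
   Context: $\mathrm{LM}(f)$ and $\mathrm{LC}(f)$ denote the leading monomial and leading coefficient of a non-zero polynomial $f$. $F$ is a Gröbner basis if the initial ideal $\langle \mathrm{LM}(f)\mid f\in I\setminus\{0\}\rangle$ is generated by $\mathrm{LM}(F)=(\mathrm{LM}(f_1),\ldots,\mathrm{LM}(f_m))$. $R^m=\bigoplus_{i=1}^m Re_i$ is the free module with basis $e_1,\ldots,e_m$; a monomial in $R^m$ is an element $x^\alpha e_i$. $R^m$ carries the Schreyer order $\prec$ of $F$: $x^\alpha e_i\prec x^\beta e_j$ iff $x^\alpha\mathrm{LM}(f_i)<x^\beta\mathrm{LM}(f_j)$, or $x^\alpha\mathrm{LM}(f_i)=x^\beta\mathrm{LM}(f_j)$ and $i<j$. For a non-zero $u\in R^m$, $\mathrm{LM}(u)$ is the $\prec$-largest monomial occurring in $u$ with non-zero coefficient; for a submodule $M\subset R^m$, $\mathrm{LM}(M)$ is the set of leading monomials of non-zero elements of $M$. For $u\in R^m$, $\bar u\in I$ is its image under the $R$-linear map $e_i\mapsto f_i$. $\mathrm{Syz}(F)$ is the kernel of this map; $\mathrm{Syz}(\mathrm{LM}(F))\subset R^m$ is the kernel of the $R$-linear map $e_i\mapsto \mathrm{LM}(f_i)$. The signature of a non-zero $f\in I$ is $S(f)=\min_\prec\{\mathrm{LM}(u)\mid u\in R^m,\ \bar u=f\}$. An S-pair of $F$ is a pair of monomials $p=(x^\gamma e_k,x^\delta e_\ell)$ in $R^m$ with $k<\ell$ and $x^\gamma\mathrm{LM}(f_k)=x^\delta\mathrm{LM}(f_\ell)$.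 Its S-polynomial is $\mathrm{Spoly}(p)=\frac{1}{\mathrm{LC}(f_k)}x^\gamma f_k-\frac{1}{\mathrm{LC}(f_\ell)}x^\delta f_\ell$, and its guessed signature is $\hat S(p)=x^\delta e_\ell$. It is standard if $x^\gamma\mathrm{LM}(f_k)=x^\delta\mathrm{LM}(f_\ell)=\mathrm{lcm}(\mathrm{LM}(f_k),\mathrm{LM}(f_\ell))$. *)

(* Defs.v *)
From mathcomp Require Import all_boot all_order all_algebra.
From mathcomp.multinomials Require Import mpoly.

Set Implicit Arguments.
Unset Strict Implicit.
Unset Printing Implicit Defensive.

Import GRing.Theory.
Local Open Scope ring_scope.

(* Strict term orders on exponent vectors; a < b encodes x^a < x^b, and the
   additive unit 0 is the exponent of the monomial 1. *)
Definition term_order (n : nat) (lt : rel 'X_{1..n}) : Prop :=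
  [/\ irreflexive lt,
      transitive lt,
      (forall a b, a != b -> lt a b || lt b a),
      (forall a, a != 0%MM -> lt 0%MM a) &
      (forall a b c, lt a b -> lt (a + c)%MM (b + c)%MM)].

(* The exponent of LM(f) with respect to lt (not to the fixed order used by
   mlead).  Since 0 is the least exponent of a term order, the neutral value is
   harmless for f != 0; for f = 0 the result is the junk value 0. *)
Definition LM (n : nat) (K : fieldType) (lt : rel 'X_{1..n})
    (f : {mpoly K[n]}) : 'X_{1..n} :=
  \big[(fun a b => if lt a b then b else a)/0%MM]_(a <- msupp f) a.

Definition LC (n : nat) (K : fieldType) (lt : rel 'X_{1..n})
    (f : {mpoly K[n]}) : K := f@_(LM lt f).

Definition ideal_gen (n : nat) (K : fieldType) (A : {mpoly K[n]} -> Prop)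
    (f : {mpoly K[n]}) : Prop :=
  exists (k : nat) (c g : 'I_k -> {mpoly K[n]}),
    (forall i, A (g i)) /\ f = \sum_(i < k) c i * g i.

Definition ideal_of (n m : nat) (K : fieldType) (F : 'I_m -> {mpoly K[n]}) :
    {mpoly K[n]} -> Prop :=
  ideal_gen (fun g => exists i, g = F i).

Definition LMF (n m : nat) (K : fieldType) (lt : rel 'X_{1..n})
    (F : 'I_m -> {mpoly K[n]}) : 'I_m -> {mpoly K[n]} :=
  fun i => 'X_[LM lt (F i)].

Definition initial_ideal (n m : nat) (K : fieldType) (lt : rel 'X_{1..n})
    (F : 'I_m -> {mpoly K[n]}) : {mpoly K[n]} -> Prop :=
  ideal_gen (fun g => exists f, [/\ ideal_of F f, f != 0 & g = 'X_[LM lt f]]).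

Definition groebner_basis (n m : nat) (K : fieldType) (lt : rel 'X_{1..n})
    (F : 'I_m -> {mpoly K[n]}) : Prop :=
  forall g, initial_ideal lt F g <-> ideal_of (LMF lt F) g.

(* R^m is the space of row vectors 'rV[{mpoly K[n]}]_m, and the pair (a, i)
   encodes its monomial x^a e_i. *)
Definition module_monomial (n m : nat) : Type := ('X_{1..n} * 'I_m)%type.

Definition mmon (n m : nat) (K : fieldType) (s : module_monomial n m) :
    'rV[{mpoly K[n]}]_m :=
  'X_[s.1] *: delta_mx 0 s.2.

(* The R-linear map e_i |-> F i; for the tuple F it is u |-> \bar u. *)
Definition bar (n m : nat) (K : fieldType) (F : 'I_m -> {mpoly K[n]})
    (u : 'rV[{mpoly K[n]}]_m) : {mpoly K[n]} :=
  \sum_(i < m) u 0 i * F i.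

Definition Syz (n m : nat) (K : fieldType) (F : 'I_m -> {mpoly K[n]})
    (u : 'rV[{mpoly K[n]}]_m) : Prop :=
  bar F u = 0.

Definition schreyer_lt (n m : nat) (K : fieldType) (lt : rel 'X_{1..n})
    (F : 'I_m -> {mpoly K[n]}) (s t : module_monomial n m) : bool :=
  let a := (s.1 + LM lt (F s.2))%MM in
  let b := (t.1 + LM lt (F t.2))%MM in
  lt a b || (a == b) && (s.2 < t.2)%N.

(* s = LM(u); no s satisfies this when u = 0. *)
Definition is_module_LM (n m : nat) (K : fieldType) (lt : rel 'X_{1..n})
    (F : 'I_m -> {mpoly K[n]}) (u : 'rV[{mpoly K[n]}]_m)
    (s : module_monomial n m) : Prop :=
  (u 0 s.2)@_(s.1) != 0 /\
  forall t : module_monomial n m,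
    (u 0 t.2)@_(t.1) != 0 -> t = s \/ schreyer_lt lt F t s.

(* Membership in LM(M), where R^m carries the Schreyer order of F. *)
Definition module_LM_set (n m : nat) (K : fieldType) (lt : rel 'X_{1..n})
    (F : 'I_m -> {mpoly K[n]}) (M : 'rV[{mpoly K[n]}]_m -> Prop)
    (s : module_monomial n m) : Prop :=
  exists u, [/\ M u, u != 0 & is_module_LM lt F u s].

(* s = S(f), meaningful for non-zero f in the ideal of F: the Schreyer order
   is then a well-order, so exactly one s satisfies this. *)
Definition is_signature (n m : nat) (K : fieldType) (lt : rel 'X_{1..n})
    (F : 'I_m -> {mpoly K[n]}) (f : {mpoly K[n]})
    (s : module_monomial n m) : Prop :=
  (exists2 u, bar F u = f & is_module_LM lt F u s) /\
  forall u t, bar F u = f -> is_module_LM lt F u t ->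
    s = t \/ schreyer_lt lt F s t.

Definition is_Spair (n m : nat) (K : fieldType) (lt : rel 'X_{1..n})
    (F : 'I_m -> {mpoly K[n]})
    (p : module_monomial n m * module_monomial n m) : Prop :=
  (p.1.2 < p.2.2)%N /\
  (p.1.1 + LM lt (F p.1.2))%MM = (p.2.1 + LM lt (F p.2.2))%MM.

Definition standard_Spair (n m : nat) (K : fieldType) (lt : rel 'X_{1..n})
    (F : 'I_m -> {mpoly K[n]})
    (p : module_monomial n m * module_monomial n m) : Prop :=
  is_Spair lt F p /\
  (p.1.1 + LM lt (F p.1.2))%MM = mlcm (LM lt (F p.1.2)) (LM lt (F p.2.2)).

Definition Spoly (n m : nat) (K : fieldType) (lt : rel 'X_{1..n})
    (F : 'I_m -> {mpoly K[n]})
    (p : module_monomial n m * module_monomial n m) : {mpoly K[n]} :=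
  (LC lt (F p.1.2))^-1 *: ('X_[p.1.1] * F p.1.2)
  - (LC lt (F p.2.2))^-1 *: ('X_[p.2.1] * F p.2.2).

Definition guessed_signature (n m : nat)
    (p : module_monomial n m * module_monomial n m) : module_monomial n m :=
  p.2.

Definition guess_not_signature (n m : nat) (K : fieldType) (lt : rel 'X_{1..n})
    (F : 'I_m -> {mpoly K[n]})
    (p : module_monomial n m * module_monomial n m) : Prop :=
  Spoly lt F p = 0 \/ ~ is_signature lt F (Spoly lt F p) (guessed_signature p).

(* Main.v *)
Require Import Defs.
From mathcomp Require Import all_boot all_order all_algebra.
From mathcomp.multinomials Require Import mpoly.
From Stdlib Require Import Classical ClassicalEpsilon.

Set Implicit Arguments.
Unset Strict Implicit.
Unset Printing Implicit Defensive.

Import GRing.Theory.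
Local Open Scope ring_scope.

(** Cancellation argument.  A vector u with LM(u) = s satisfies
    LM(bar u) <= deg s, the degree of x^a e_i being x^a LM(f_i); if the
    inequality is strict, some other monomial of u has degree deg s, and it
    forms an S-pair with s.  Hence LM(Syz(LM(F))) is the set of guessed
    signatures, and LM(Syz(F)) is contained in it.  When a guessed signature is
    not a signature, subtracting a smaller representation of the S-polynomial
    from the obvious one gives a syzygy with that leading monomial; conversely,
    such syzygies reduce any representation whose leading terms cancel, so that
    a minimal one, which exists by Dickson's lemma, has no cancellation. *)

(** * Dickson's lemma *)

Lemma tail_minimum (g : nat -> nat) (N : nat) :
  exists i, (N <= i)%N /\ forall j, (N <= j)%N -> (g i <= g j)%N.
Proof.
(* Descent on a bound [k] for the value at a candidate index [i]: if [i] is not minimal, a better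
   index has value at most [k - 1]. *)
suff H k i : (g i <= k)%N -> (N <= i)%N ->
    exists i, (N <= i)%N /\ forall j, (N <= j)%N -> (g i <= g j)%N.
  exact: (H (g N) N).
elim: k i => [|k IHk] i gik Ni.
  by exists i; split=> // j _; apply: leq_trans gik _.
have [[j [Nj gji]]|H] := classic (exists j, (N <= j)%N /\ (g j < g i)%N).
  by apply: (IHk j) => //; rewrite -ltnS; apply: leq_trans gji gik.
exists i; split=> // j Nj; rewrite leqNgt; apply/negP=> gji.
by apply: H; exists j.
Qed.

(** Each new index minimises [g] on the tail that starts just after the previous one. A minimiser on
    a tail is a lower bound for all later values, so the chosen values never decrease. *)
Lemma nondecreasing_subsequence (g : nat -> nat) :
  exists phi : nat -> nat,
    {homo phi : i j / (i < j)%N} /\ {homo g \o phi : i j / (i <= j)%N}.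
Proof.
pose h N := proj1_sig (constructive_indefinite_description _ (tail_minimum g N)).
have hP N : (N <= h N)%N /\ forall j, (N <= j)%N -> (g (h N) <= g j)%N.
  by rewrite /h; case: constructive_indefinite_description.
pose phi := fix phi i := if i is i'.+1 then h (phi i').+1 else h 0%N.
have phi_lt : {homo phi : i j / (i < j)%N}.
  apply: homo_ltn => [|i] /=; first by move=> ? ? ?; apply: ltn_trans.
  by case: (hP (phi i).+1).
exists phi; split=> // i j le_ij /=.
have [N def_i le_N] : exists2 N, phi i = h N & (N <= phi i)%N.
  case: i {le_ij} => [|i] /=; first by exists 0%N.
  by exists (phi i).+1 => //; case: (hP (phi i).+1).
rewrite {1}def_i; case: (hP N) => _; apply; apply: leq_trans le_N _.
by move: le_ij; rewrite leq_eqVlt => /predU1P[<- //|/phi_lt /ltnW].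
Qed.

Lemma dickson (n : nat) (f : nat -> 'X_{1..n}) :
  exists i j, (i < j)%N /\ (f i <= f j)%MM.
Proof.
(* Subsequences are extracted one coordinate at a time; after [l] rounds the first [l] coordinates
   are nondecreasing, and further extraction preserves this. *)
suff /(_ n (leqnn n))[phi [phi_lt H]] : forall l, (l <= n)%N ->
    exists phi : nat -> nat, {homo phi : i j / (i < j)%N} /\
      forall k : 'I_n, (k < l)%N -> {homo (fun i => f (phi i) k) : i j / (i <= j)%N}.
  exists (phi 0%N), (phi 1%N); split; first exact: phi_lt.
  by apply/mnm_lepP=> k; exact: (H k (ltn_ord k) 0%N 1%N isT).
elim=> [|l IHl] ltln; first by exists id; split=> [i j|k]; rewrite ?ltn0.
have [phi [phi_lt H]] := IHl (ltnW ltln).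
have [psi [psi_lt Hpsi]] := nondecreasing_subsequence (fun i => f (phi i) (Ordinal ltln)).
exists (phi \o psi); split=> [i j lt_ij|k]; first exact/phi_lt/psi_lt.
rewrite ltnS leq_eqVlt => /predU1P[kl|lt_kl] i j le_ij /=.
  have -> : k = Ordinal ltln by apply: val_inj.
  exact: Hpsi.
apply: H lt_kl _ _ _; move: le_ij; rewrite leq_eqVlt => /predU1P[-> //|].
by move/psi_lt/ltnW.
Qed.

Lemma mnm_repr (n : nat) (a b : 'X_{1..n}) : (a <= b)%MM -> exists c, b = (c + a)%MM.
Proof. by move=> le_ab; exists (b - a)%MM; rewrite submK. Qed.

Lemma sum_neq0_exists (V : zmodType) (I : finType) (E : I -> V) :
  \sum_i E i != 0 -> exists i, E i != 0.
Proof.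
move=> nz; apply/existsP; apply: contraNT nz; rewrite negb_exists => /forallP H.
by apply/eqP; apply: big1 => i _; apply/eqP; rewrite -[_ == _]negbK.
Qed.

(** * Term orders: monotonicity and well-foundedness *)

Section TermOrder.

Variables (n : nat) (lt : rel 'X_{1..n}).
Hypothesis hlt : term_order lt.

Local Notation le a b := ((a == b) || lt a b).

Lemma tlt_irr a : lt a a = false.
Proof. by case: hlt. Qed.

Lemma tlt_trans b a c : lt a b -> lt b c -> lt a c.
Proof. by case: hlt => _ H _ _ _; apply: H. Qed.

Lemma tlt_total a b : a != b -> lt a b || lt b a.
Proof. by case: hlt => _ _ H _ _; apply: H. Qed.

Lemma tlt0 a : a != 0%MM -> lt 0%MM a.
Proof. by case: hlt => _ _ _ H _; apply: H. Qed.

Lemma tltD2r a b c : lt (a + c)%MM (b + c)%MM = lt a b.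
Proof.
have H x y : lt x y -> lt (x + c)%MM (y + c)%MM by case: hlt => _ _ _ _; apply.
apply/idP/idP=> [lt_ab|]; last exact: H.
have [eq_ab|/tlt_total/orP[//|/H lt_ba]] := eqVneq a b.
  by rewrite eq_ab tlt_irr in lt_ab.
by have := tlt_trans lt_ab lt_ba; rewrite tlt_irr.
Qed.

Lemma tltNle a b : lt a b -> ~~ le b a.
Proof.
move=> lt_ab; apply/negP=> /predU1P[eq_ab|lt_ba].
  by rewrite eq_ab tlt_irr in lt_ab.
by have := tlt_trans lt_ab lt_ba; rewrite tlt_irr.
Qed.

Lemma tle_lt_trans b a c : le a b -> lt b c -> lt a c.
Proof. by move=> /predU1P[->//|]; apply: tlt_trans. Qed.

Lemma tlt_le_trans b a c : lt a b -> le b c -> lt a c.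
Proof. by move=> lt_ab /predU1P[<-//|]; apply: tlt_trans. Qed.

Lemma tle_trans b a c : le a b -> le b c -> le a c.
Proof. by move=> /predU1P[->//|lt_ab] /(tlt_le_trans lt_ab) ->; rewrite orbT. Qed.

Lemma tltD_le a b c d : lt a b -> le c d -> lt (a + c)%MM (b + d)%MM.
Proof.
move=> lt_ab le_cd; apply: (@tlt_le_trans (b + c)%MM); first by rewrite tltD2r.
by rewrite ![(b + _)%MM]addmC eqm_add2r tltD2r.
Qed.

Lemma tleD a b c d : le a b -> le c d -> le (a + c)%MM (b + d)%MM.
Proof.
move=> /predU1P[->|lt_ab] le_cd; first by rewrite ![(b + _)%MM]addmC eqm_add2r tltD2r.
by rewrite (tltD_le lt_ab le_cd) orbT.
Qed.

Lemma divides_tle a b : (a <= b)%MM -> le a b.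
Proof.
case/mnm_repr=> c ->; rewrite -{1 3}[a]add0m eqm_add2r tltD2r eq_sym.
by case: eqVneq => //= /tlt0.
Qed.

(** A non-accessible exponent starts, by choice, an infinite strictly descending sequence. Dickson's
    lemma finds an earlier term dividing a later one, and divisibility implies [le], a
    contradiction. *)
Lemma tlt_wf : well_founded (fun a b => is_true (lt a b)).
Proof.
move=> a0; apply: NNPP => nAcc0.
pose T := {a | ~ Acc (fun a b => is_true (lt a b)) a}.
have nextP (x : T) : exists y : T, lt (proj1_sig y) (proj1_sig x).
  case: x => a nAcc /=; apply: NNPP => H; apply: nAcc; constructor=> b lt_ba.
  by apply: NNPP => nAccb; apply: H; exists (exist _ b nAccb).
pose next x := proj1_sig (constructive_indefinite_description _ (nextP x)).
have next_lt x : lt (proj1_sig (next x)) (proj1_sig x).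
  by rewrite /next; case: constructive_indefinite_description.
pose f i := proj1_sig (iter i next (exist _ a0 nAcc0 : T)).
have f_lt i j : (i < j)%N -> lt (f j) (f i).
  apply: (@homo_ltn _ f (fun x y => lt y x)) => [y x z lt1 lt2|k].
    exact: tlt_trans lt2 lt1.
  exact: next_lt.
have [i [j [/f_lt lt_ji /divides_tle]]] := dickson f.
by apply/negP/tltNle.
Qed.

(** * Leading monomials of polynomials *)

Section Polynomials.

Variable K : fieldType.
Implicit Types (f p q : {mpoly K[n]}).

Lemma LM_list_max (r : seq 'X_{1..n}) :
  let M := \big[(fun a b => if lt a b then b else a)/0%MM]_(a <- r) a in
  (forall a, a \in r -> le a M) /\ (r != [::] -> M \in r).
Proof.
elim: r => [|a r [IHle IHin]] /=; first by rewrite big_nil.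
rewrite big_cons; set M := \big[_/_]_(_ <- _) _ in IHle IHin *.
have [lt_aM|nlt_aM] := boolP (lt a M); split=> [b|_].
- by rewrite inE => /predU1P[->|/IHle //]; rewrite lt_aM orbT.
(* An empty [r] would make [M] the default value 0, and no exponent lies below 0. *)
- rewrite inE IHin ?orbT //; apply: contraTneq lt_aM => r0.
  rewrite /M r0 big_nil; have [->|/tlt0 /tltNle] := eqVneq a 0%MM; first by rewrite tlt_irr.
  by rewrite negb_or => /andP[].
- rewrite inE => /predU1P[->|/IHle]; first by rewrite eqxx.
  move=> le_bM; apply: tle_trans le_bM _.
  case: eqVneq => //= /tlt_total; rewrite (negPf nlt_aM) orbF; exact.
- by rewrite mem_head.
Qed.

Lemma msupp_le_LM f a : a \in msupp f -> le a (LM lt f).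
Proof. exact: (LM_list_max (msupp f)).1. Qed.

Lemma LC_neq0 f : f != 0 -> LC lt f != 0.
Proof.
by rewrite -msupp_eq0 /LC -mcoeff_msupp => /(LM_list_max (msupp f)).2.
Qed.

Lemma LM_unique f a :
  f@_a != 0 -> (forall b, b \in msupp f -> le b a) -> LM lt f = a.
Proof.
move=> nz max; have nz_f : f != 0 by apply: contraNneq nz => ->; rewrite mcoeff0.
have /max/predU1P[//|lt_a] : LM lt f \in msupp f by rewrite mcoeff_msupp LC_neq0.
by have := tltNle lt_a; rewrite msupp_le_LM // mcoeff_msupp.
Qed.

Lemma LM_X a : LM lt ('X_[a] : {mpoly K[n]}) = a.
Proof.
apply: LM_unique => [|b]; first by rewrite mcoeffX eqxx oner_neq0.
by rewrite msuppX inE => ->.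
Qed.

Lemma msuppM_exists p q a : (p * q)@_a != 0 ->
  exists b c, [/\ b \in msupp p, c \in msupp q & a = (b + c)%MM].
Proof.
rewrite -mcoeff_msupp => /msuppM_le/allpairsP[[b c] /= [pb qc ->]].
by exists b, c.
Qed.

(** Only the two top terms meet in this coefficient: after the [a]-term of [p] is split off, every
    remaining exponent of [p] is strictly below [a], and its sum with an exponent of [q] stays
    strictly below [a + b]. *)
Lemma mcoeffM_top p q a b :
  (forall c, c \in msupp p -> le c a) -> (forall c, c \in msupp q -> le c b) ->
  (p * q)@_(a + b)%MM = p@_a * q@_b.
Proof.
move=> le_pa le_qb; rewrite -[p in LHS](subrK (p@_a *: 'X_[a])) mulrDl mcoeffD.
rewrite -scalerAl mcoeffZ ['X_[a] * q]mulrC mcoeffMX.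
rewrite [X in X + _ = _](_ : _ = 0) ?add0r //; apply/eqP.
apply: contraTT isT => /msuppM_exists[c [d [pc /le_qb qd def_ab]]].
have ca : c != a.
  apply: contraTneq pc => ->.
  by rewrite mcoeff_msupp mcoeffB mcoeffZ mcoeffX eqxx mulr1 subrr eqxx.
have : c \in msupp p.
  move: pc; rewrite !mcoeff_msupp mcoeffB mcoeffZ mcoeffX [a == c]eq_sym (negPf ca).
  by rewrite mulr0 subr0.
move/le_pa; rewrite (negPf ca) => /= lt_ca.
by have := tltD_le lt_ca qd; rewrite def_ab tlt_irr.
Qed.

End Polynomials.

End TermOrder.

(** * The linear map from the free module onto the ideal *)

Section Bar.

Variables (K : fieldType) (n m : nat).
Implicit Types (G : 'I_m -> {mpoly K[n]}) (u v : 'rV[{mpoly K[n]}]_m).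

Lemma bar_mulmx G u : bar G u = (u *m \col_i G i) 0 0.
Proof. by rewrite mxE; apply: eq_bigr => i _; rewrite mxE. Qed.

Lemma barD G u v : bar G (u + v) = bar G u + bar G v.
Proof. by rewrite !bar_mulmx mulmxDl mxE. Qed.

Lemma barB G u v : bar G (u - v) = bar G u - bar G v.
Proof. by rewrite !bar_mulmx mulmxBl !mxE. Qed.

Lemma barZ G c u : bar G (c *: u) = c * bar G u.
Proof. by rewrite !bar_mulmx -scalemxAl mxE. Qed.

Lemma bar_delta G i : bar G (delta_mx 0 i) = G i.
Proof. by rewrite bar_mulmx -rowE !mxE. Qed.

Lemma bar_mmon G s : bar G (mmon K s) = 'X_[s.1] * G s.2.
Proof. by rewrite barZ bar_delta. Qed.

Lemma bar_mmonZ G c s : bar G (c%:MP *: mmon K s) = c *: ('X_[s.1] * G s.2).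
Proof. by rewrite barZ bar_mmon mul_mpolyC. Qed.

Lemma bar_sum G (I : finType) (U : I -> 'rV_m) :
  bar G (\sum_i U i) = \sum_i bar G (U i).
Proof. by rewrite bar_mulmx mulmx_suml summxE; apply: eq_bigr => i _; rewrite bar_mulmx. Qed.

Lemma mcoeff_mmon (s t : module_monomial n m) :
  (mmon K s 0 t.2)@_t.1 = ((t.1 == s.1) && (t.2 == s.2))%:R.
Proof.
rewrite !mxE eqxx /= mulr_natr mcoeffMn mcoeffX eq_sym.
by case: (t.1 == s.1); case: (t.2 == s.2).
Qed.

(** Serves twice: for the ideal of [F] itself, and to place the initial ideal inside the ideal
    generated by the [LM(f_i)]. *)
Lemma ideal_gen_bar (A : {mpoly K[n]} -> Prop) G f :
  (forall g, A g -> exists u, bar G u = g) -> ideal_gen A f -> exists u, bar G u = f.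
Proof.
move=> AG [k [c [g [Ag ->]]]].
have /fin_all_exists[U barU] i : exists u, bar G u = c i * g i.
  by have [u <-] := AG _ (Ag i); exists (c i *: u); rewrite barZ.
by exists (\sum_i U i); rewrite bar_sum; apply: eq_bigr => i _; rewrite barU.
Qed.

Lemma ideal_ofP G f : ideal_of G f <-> exists u, bar G u = f.
Proof.
split=> [|[u <-]]; last by exists m, (u 0), G; split=> // i; exists i.
by apply: ideal_gen_bar => _ [i ->]; exists (delta_mx 0 i); rewrite bar_delta.
Qed.

Lemma mcoeff_bar_neq0 G u a : (bar G u)@_a != 0 ->
  exists i b c, [/\ (u 0 i)@_b != 0, (G i)@_c != 0 & a = (b + c)%MM].
Proof.
rewrite raddf_sum /= => /sum_neq0_exists[i /msuppM_exists[b [c []]]].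
by rewrite !mcoeff_msupp => ub Gc ->; exists i, b, c.
Qed.

End Bar.

(** * The Schreyer order *)

Section Schreyer.

Variables (K : fieldType) (n m : nat) (lt : rel 'X_{1..n}).
Hypothesis hlt : term_order lt.

Local Notation le a b := ((a == b) || lt a b).

Implicit Types (F : 'I_m -> {mpoly K[n]}) (u v : 'rV[{mpoly K[n]}]_m).
Implicit Types (s t : module_monomial n m).

Definition schreyer_deg F s : 'X_{1..n} := (s.1 + LM lt (F s.2))%MM.

Lemma schreyer_irr F s : schreyer_lt lt F s s = false.
Proof. by rewrite /schreyer_lt tlt_irr // ltnn andbF. Qed.

Lemma schreyer_trans F t s r :
  schreyer_lt lt F s t -> schreyer_lt lt F t r -> schreyer_lt lt F s r.
Proof.
rewrite /schreyer_lt /= => /orP[lt_st|/andP[/eqP-> lt_st]] /orP[lt_tr|/andP[/eqP<- lt_tr]].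
- by rewrite (tlt_trans hlt lt_st lt_tr).
- by rewrite lt_st.
- by rewrite lt_tr.
- by rewrite eqxx (ltn_trans lt_st lt_tr) orbT.
Qed.

Lemma schreyer_total F s t : [\/ s = t, schreyer_lt lt F s t | schreyer_lt lt F t s].
Proof.
rewrite /schreyer_lt.
have [eqd|/(tlt_total hlt)/orP[->|->]] := eqVneq (s.1 + LM lt (F s.2))%MM (t.1 + LM lt (F t.2))%MM;
  [|by constructor 2|by constructor 3].
rewrite eqd tlt_irr //=; case: (ltngtP s.2 t.2) => [_|_|/val_inj eq2].
- by constructor 2.
- by constructor 3.
constructor 1; move: eqd eq2; case: s t => [a i] [b j] /= eqd eq2.
by move: eqd; rewrite eq2 => /addIm ->.
Qed.

Lemma schreyer_lt_deg F s t :
  schreyer_lt lt F s t -> le (schreyer_deg F s) (schreyer_deg F t).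
Proof. by case/orP=> [->|/andP[-> _]]; rewrite ?orbT. Qed.

(** The order is lexicographic in the degree and the index: the outer induction uses that the term
    order is well-founded, the inner one runs over indices at fixed degree. *)
Lemma schreyer_wf F : well_founded (fun s t => is_true (schreyer_lt lt F s t)).
Proof.
suff H D k s : schreyer_deg F s = D -> nat_of_ord s.2 = k ->
    Acc (fun s t => is_true (schreyer_lt lt F s t)) s by move=> s; exact: (H _ _ s erefl erefl).
elim/(well_founded_ind (tlt_wf hlt)): D k s => D IHD k.
elim/ltn_ind: k => k IHk s def_D def_k; constructor=> t.
case/orP=> [lt_ts|/andP[/eqP eq_ts lt_ts]].
  by apply: (IHD (schreyer_deg F t)) => //; rewrite -def_D.
by apply: (IHk t.2) => //; [rewrite -def_k | rewrite -def_D].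
Qed.

Lemma schreyer_shift F c s t :
  schreyer_lt lt F ((c + s.1)%MM, s.2) ((c + t.1)%MM, t.2) = schreyer_lt lt F s t.
Proof.
by rewrite /schreyer_lt /= -!addmA ![(c + _)%MM]addmC tltD2r // eqm_add2r.
Qed.

Lemma schreyer_max F (r : seq ('X_{1..n} * 'I_m)%type) : r != [::] ->
  exists2 s, s \in r & forall t, t \in r -> t = s \/ schreyer_lt lt F t s.
Proof.
elim: r => // a [|b r] IHr _.
  by exists a => [|t]; rewrite inE // => /eqP->; left.
have [//|s rs max_s] := IHr.
have [<-|lt_as|lt_sa] := schreyer_total F s a.
- by exists s => [|t]; rewrite inE ?eqxx // => /predU1P[->|/max_s]; [left|].
- exists a => [|t]; rewrite inE ?eqxx // => /predU1P[->|/max_s[->|lt_ts]]; [by left|by right|].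
  by right; apply: schreyer_trans lt_ts lt_as.
- by exists s => [|t]; rewrite inE ?rs ?orbT // => /predU1P[->|/max_s]; [right|].
Qed.

(** * Leading monomials of vectors *)

Lemma module_LM_exists F u : u != 0 -> exists s, is_module_LM lt F u s.
Proof.
move=> nz; pose r := [seq (a, i) | i <- enum 'I_m, a <- msupp (u 0 i)].
have in_r t : (t \in r) = ((u 0 t.2)@_t.1 != 0).
  rewrite -mcoeff_msupp; apply/allpairsPdep/idP => [[i [a [_ ua ->]]] //|ut].
  by exists t.2, t.1; rewrite mem_enum; case: t ut.
have /(schreyer_max F)[s rs max_s] : r != [::].
  apply: contraNneq nz => r0; apply/eqP/rowP=> i; rewrite mxE; apply/mpolyP=> a.
  by have := in_r (a, i); rewrite r0 mcoeff0 => /esym/negbFE/eqP.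
by exists s; split=> [|t]; rewrite -in_r //; apply: max_s.
Qed.

Lemma module_LM_neq0 F u s : is_module_LM lt F u s -> u != 0.
Proof. by case=> nz _; apply: contraNneq nz => ->; rewrite mxE mcoeff0. Qed.

Lemma module_LM_deg F u s t : is_module_LM lt F u s -> (u 0 t.2)@_t.1 != 0 ->
  le (schreyer_deg F t) (schreyer_deg F s).
Proof. by case=> _ H /H[->|/schreyer_lt_deg //]; rewrite eqxx. Qed.

Lemma module_LM_add F u v s : is_module_LM lt F u s ->
  (forall t, (v 0 t.2)@_t.1 != 0 -> schreyer_lt lt F t s) ->
  is_module_LM lt F (u + v) s.
Proof.
move=> [us max_s] vlt; split=> [|t]; rewrite mxE mcoeffD.
  have [->|/vlt] := eqVneq (v 0 s.2)@_s.1 0; first by rewrite addr0.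
  by rewrite schreyer_irr.
have [->|/vlt lt_ts _] := eqVneq (v 0 t.2)@_t.1 0; last by right.
by rewrite addr0; apply: max_s.
Qed.

Lemma module_LM_sub F u v s t : is_module_LM lt F u s -> is_module_LM lt F v t ->
  schreyer_lt lt F t s -> is_module_LM lt F (u - v) s.
Proof.
move=> LMu [_ max_t] lt_ts; apply: module_LM_add LMu _ => r.
rewrite mxE mcoeffN oppr_eq0 => /max_t[-> //|lt_rt].
exact: schreyer_trans lt_rt lt_ts.
Qed.

Lemma module_LM_scale F c u s : c != 0 -> is_module_LM lt F u s ->
  is_module_LM lt F (c%:MP *: u) s.
Proof.
move=> nz [us max_s]; split=> [|t]; rewrite mxE mcoeffCM mulf_eq0 (negPf nz) //=.
exact: max_s.
Qed.

Lemma module_LM_mmon F s : is_module_LM lt F (mmon K s) s.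
Proof.
split=> [|t]; first by rewrite mcoeff_mmon !eqxx oner_neq0.
rewrite mcoeff_mmon; case: s t => a i [b j] /=.
case: (b =P a) => [->|_] /=; last by rewrite eqxx.
by case: (j =P i) => [->|_] /=; [left | rewrite eqxx].
Qed.

Lemma module_LM_shift F c u s : is_module_LM lt F u s ->
  is_module_LM lt F ('X_[c] *: u) ((c + s.1)%MM, s.2).
Proof.
move=> [us max_s]; split=> [|[a i]] /=; rewrite mxE mulrC; first by rewrite mcoeffMX.
case/msuppM_exists=> b [d [ub]]; rewrite msuppX inE => /eqP-> ->.
rewrite mcoeff_msupp in ub; rewrite addmC.
have [|lt_ts] := max_s (b, i) ub; first by case: s {us max_s} => ? ? [-> ->]; left.
by right; have := schreyer_shift F c (b, i) s; rewrite /= => ->.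
Qed.

(** * Degrees of images, cancellation and signatures *)

Lemma bar_le_deg F u D :
  (forall t, (u 0 t.2)@_t.1 != 0 -> le (schreyer_deg F t) D) ->
  forall a, a \in msupp (bar F u) -> le a D.
Proof.
move=> le_uD a; rewrite mcoeff_msupp => /mcoeff_bar_neq0[i [b [c [ub Fc ->]]]].
apply: (tle_trans hlt) (le_uD (b, i) ub); apply: tleD => //; first by rewrite eqxx.
by apply: msupp_le_LM => //; rewrite mcoeff_msupp.
Qed.

(* The coefficient of [bar F u] at the degree of LM(u) collects contributions
   from the monomials of u of that degree only; if it vanishes, LM(u) cannot be
   the only one, and the Schreyer order puts all others at smaller indices. *)
Lemma leading_cancellation F u s : (forall i, F i != 0) ->
  is_module_LM lt F u s -> (bar F u)@_(schreyer_deg F s) = 0 ->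
  exists t, is_Spair lt F (t, s).
Proof.
move=> hF LMu; have [us max_s] := LMu.
have le_us c : c \in msupp (u 0 s.2) -> le c s.1.
  rewrite mcoeff_msupp => /(module_LM_deg (t := (c, s.2)) LMu).
  by rewrite /schreyer_deg /= eqm_add2r tltD2r.
rewrite raddf_sum (bigD1 s.2) //= (mcoeffM_top hlt le_us (msupp_le_LM hlt (f := F s.2))).
move=> top0; apply: NNPP => noS; move/eqP: top0; apply/negP.
rewrite big1 ?addr0 => [|i i_neq]; first by rewrite mulf_neq0 // LC_neq0.
apply/eqP; apply: contraT => /msuppM_exists[b [c [ub Fc def_deg]]].
rewrite mcoeff_msupp in ub.
have le_cLM : le c (LM lt (F i)) by apply: msupp_le_LM.
have [def_c|c_neq] := eqVneq c (LM lt (F i)).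
  have [eq_s|/orP[]] := max_s (b, i) ub.
  - by rewrite -eq_s eqxx in i_neq.
  - by rewrite /= -def_c -def_deg tlt_irr.
  - case/andP=> /eqP eq_deg lt_is; case: noS.
    by exists (b, i); split.
rewrite (negPf c_neq) /= in le_cLM.
have lt_deg : lt (schreyer_deg F s) (schreyer_deg F (b, i)).
  by rewrite def_deg /schreyer_deg /= ![(b + _)%MM]addmC tltD2r.
by have := tltNle hlt lt_deg; rewrite (module_LM_deg LMu).
Qed.

(** Well-founded descent on the leading monomial of a representation: either no representation has a
    smaller one, or the search continues from such a representation. *)
Lemma signature_exists F u f : f != 0 -> bar F u = f -> exists s, is_signature lt F f s.
Proof.
move=> nz_f bar_u; have nz_u : u != 0.
  by apply: contraNneq nz_f => u0; rewrite -bar_u u0 bar_mulmx mul0mx mxE.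
have [s LMu] := module_LM_exists F nz_u.
elim/(well_founded_ind (schreyer_wf F)): s u bar_u LMu {nz_u} => s IHs u bar_u LMu.
have [[v [t [bar_v LMv lt_ts]]]|min_s] := classic (exists v t,
  [/\ bar F v = f, is_module_LM lt F v t & schreyer_lt lt F t s]); first exact: (IHs t lt_ts v).
exists s; split=> [|v t bar_v LMv]; first by exists u.
have [eq_st|lt_st|lt_ts] := schreyer_total F s t; [by left|by right|].
by case: min_s; exists v, t.
Qed.

Lemma mcoeffXM_schreyer_deg F s :
  ('X_[s.1] * F s.2)@_(schreyer_deg F s) = LC lt (F s.2).
Proof. by rewrite mulrC mcoeffMX. Qed.

(** A single module monomial leaves no room for cancellation. This turns condition (e) into a
    statement on the degree of the signature. *)
Lemma LM_bar_mmon F s : F s.2 != 0 -> LM lt (bar F (mmon K s)) = schreyer_deg F s.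
Proof.
move=> nz; apply: LM_unique => //.
  by rewrite bar_mmon mcoeffXM_schreyer_deg LC_neq0.
apply: bar_le_deg => t /(module_LM_deg (module_LM_mmon F s)); exact.
Qed.

(** * S-pairs and the syzygies of the leading monomials *)

Definition Spair_vector F (p : module_monomial n m * module_monomial n m) : 'rV_m :=
  (LC lt (F p.1.2))^-1%:MP *: mmon K p.1 - (LC lt (F p.2.2))^-1%:MP *: mmon K p.2.

Lemma bar_Spair_vector F p : bar F (Spair_vector F p) = Spoly lt F p.
Proof. by rewrite barB !bar_mmonZ. Qed.

(** Both monomials have the same degree, so the tie is broken by the index, which is larger for
    [p.2]. *)
Lemma module_LM_Spair_vector F p : (forall i, F i != 0) -> is_Spair lt F p ->
  is_module_LM lt F (Spair_vector F p) p.2.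
Proof.
move=> hF [lt12 eqdeg]; have nz i : (LC lt (F i))^-1 != 0 by rewrite invr_neq0 ?LC_neq0.
(* The difference is reversed so that the larger monomial comes first, as [module_LM_sub]
   requires. *)
rewrite /Spair_vector -opprB -scaleN1r -[1]/(1%:MP) -mpolyCN.
apply: module_LM_scale; first by rewrite oppr_eq0 oner_neq0.
apply: module_LM_sub (module_LM_scale _ (module_LM_mmon _ _))
  (module_LM_scale _ (module_LM_mmon _ _)) _ => //.
by rewrite /schreyer_lt eqdeg eqxx lt12 orbT.
Qed.

Lemma LM_LMF F i : LM lt (LMF lt F i) = LM lt (F i).
Proof. exact: LM_X. Qed.

Lemma LMF_neq0 F i : LMF lt F i != 0.
Proof. by rewrite -msupp_eq0 msuppX. Qed.

(** The order depends on [F] only through its leading monomials, so results proved for arbitrary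
    tuples can be applied to [LMF lt F] and carried back to the Schreyer order of [F]. *)
Lemma schreyer_lt_LMF F : schreyer_lt lt (LMF lt F) =2 schreyer_lt lt F.
Proof. by move=> s t; rewrite /schreyer_lt !LM_LMF. Qed.

Lemma is_module_LM_LMF F u s :
  is_module_LM lt (LMF lt F) u s <-> is_module_LM lt F u s.
Proof. by split=> -[us max_s]; split=> // t /max_s; rewrite schreyer_lt_LMF. Qed.

Lemma is_Spair_LMF F p : is_Spair lt (LMF lt F) p <-> is_Spair lt F p.
Proof. by rewrite /is_Spair !LM_LMF. Qed.

Lemma Spoly_LMF F p : is_Spair lt F p -> Spoly lt (LMF lt F) p = 0.
Proof.
case=> _ eqdeg; rewrite /Spoly /LC !LM_LMF !mcoeffX !eqxx invr1 !scale1r.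
by rewrite -!mpolyXD eqdeg subrr.
Qed.

Lemma Syz_leading F s : (forall i, F i != 0) ->
  module_LM_set lt F (Syz F) s -> exists t, is_Spair lt F (t, s).
Proof.
move=> hF [u [syz_u _ LMu]]; apply: leading_cancellation LMu _ => //.
by rewrite syz_u mcoeff0.
Qed.

(** One direction is cancellation applied to the tuple [LMF lt F]; for the other, the S-polynomials
    of monomials vanish, so the vector of the S-pair is itself a syzygy. *)
Lemma Syz_LMF_leading F s :
  module_LM_set lt F (Syz (LMF lt F)) s <-> exists t, is_Spair lt F (t, s).
Proof.
split=> [[u [syz_u nz LMu]]|[t Sp]].
  have [|t /is_Spair_LMF Sp] := @Syz_leading (LMF lt F) s (LMF_neq0 F); last by exists t.
  by exists u; split=> //; apply/is_module_LM_LMF.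
have LMu := module_LM_Spair_vector (LMF_neq0 F) ((is_Spair_LMF F (t, s)).2 Sp).
exists (Spair_vector (LMF lt F) (t, s)); split; last exact/is_module_LM_LMF.
  by rewrite /Syz bar_Spair_vector Spoly_LMF.
exact: module_LM_neq0 LMu.
Qed.

(** The common degree is divisible by both leading monomials, hence by their lcm; the quotient is
    [c]. *)
Lemma Spair_standard F t s : is_Spair lt F (t, s) ->
  exists c p, [/\ standard_Spair lt F p & s = ((c + p.2.1)%MM, p.2.2)].
Proof.
case: t s => [a k] [b l] [/= lt_kl eqdeg].
set A := LM lt (F k) in eqdeg; set B := LM lt (F l) in eqdeg.
have [c def_c] : exists c, (b + B)%MM = (c + mlcm A B)%MM.
  by apply: mnm_repr; rewrite lem_mlcm -{1}eqdeg !lem_addl.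
exists c, ((mlcm A B - A)%MM, k, ((mlcm A B - B)%MM, l)); split; last first.
  congr (_, _); apply: (@addIm _ B).
  by rewrite /= -addmA submK ?lem_mlcmr.
by split; rewrite /is_Spair /= !submK ?lem_mlcml ?lem_mlcmr.
Qed.

(** * The individual implications *)

Section Equivalences.

Variable F : 'I_m -> {mpoly K[n]}.
Hypothesis hF : forall i, F i != 0.

(** Once the monomial [LM(f)] is written as a combination of the [LM(f_i)], its nonzero coefficient
    must come from a multiple of some [LM(f_i)]. *)
Lemma groebner_LM_divides f : groebner_basis lt F -> ideal_of F f -> f != 0 ->
  exists s : module_monomial n m, schreyer_deg F s = LM lt f.
Proof.
move=> gb If nz; have /gb/ideal_ofP[v bar_v] : initial_ideal lt F 'X_[LM lt f].
  exists 1%N, (fun=> 1), (fun=> 'X_[LM lt f]).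
  by split=> [_|]; [exists f | rewrite big_ord1 mul1r].
have : (bar (LMF lt F) v)@_(LM lt f) != 0 by rewrite bar_v mcoeffX eqxx oner_neq0.
case/mcoeff_bar_neq0=> i [b [c [_]]]; rewrite -mcoeff_msupp msuppX inE => /eqP-> ->.
by exists (b, i).
Qed.

(** Division by [F], as a well-founded induction on [LM(f)]: each step removes the leading term and
    leaves an element of the ideal with smaller leading monomial, or zero. *)
Lemma groebner_standard_repr f : groebner_basis lt F -> ideal_of F f -> f != 0 ->
  exists2 u, bar F u = f &
    forall t, (u 0 t.2)@_t.1 != 0 -> le (schreyer_deg F t) (LM lt f).
Proof.
move=> gb; move: {2}(LM lt f) (erefl (LM lt f)) => D.
elim/(well_founded_ind (tlt_wf hlt)): D f => D IHD f def_D If nz.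
have [s deg_s] := groebner_LM_divides gb If nz.
(* The quotient [c] makes the leading term of [bar F w] equal to that of [f]. *)
pose c := LC lt f / LC lt (F s.2); pose w := c%:MP *: mmon K s.
have le_w t : (w 0 t.2)@_t.1 != 0 -> le (schreyer_deg F t) D.
  rewrite mxE mcoeffCM mulf_eq0 negb_or => /andP[_].
  by move/(module_LM_deg (module_LM_mmon F s)); rewrite deg_s def_D.
pose g := f - bar F w.
have top_g : g@_D = 0.
  rewrite mcoeffB bar_mmonZ mcoeffZ -def_D -{2}deg_s mcoeffXM_schreyer_deg.
  by rewrite /c divfK ?LC_neq0 ?subrr.
have le_g a : a \in msupp g -> le a D.
  move/msuppB_le; rewrite mem_cat => /orP[/(msupp_le_LM hlt)|]; first by rewrite def_D.
  exact: bar_le_deg.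
rewrite def_D; have [g0|nz_g] := eqVneq g 0.
  by exists w => //; apply/esym/eqP; rewrite -subr_eq0; apply/eqP.
have lt_gD : lt (LM lt g) D.
  have := le_g (LM lt g); rewrite mcoeff_msupp LC_neq0 // => /(_ isT)/predU1P[eq_D|//].
  by have := LC_neq0 hlt nz_g; rewrite /LC eq_D top_g eqxx.
have [||v bar_v le_v] := IHD _ lt_gD g erefl; [|done|].
  have /ideal_ofP[u bar_u] := If; apply/ideal_ofP; exists (u - w).
  by rewrite barB bar_u.
exists (w + v) => [|t]; first by rewrite barD bar_v addrC subrK.
rewrite mxE mcoeffD; have [->|/le_w //] := eqVneq (w 0 t.2)@_t.1 0.
rewrite add0r => /le_v le_t; apply: (tle_trans hlt le_t); by rewrite lt_gD orbT.
Qed.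

(** Dividing by the leading coefficients makes the two terms of degree [schreyer_deg F p.2]
    cancel. *)
Lemma Spoly_LM_lt p : is_Spair lt F p -> Spoly lt F p != 0 ->
  lt (LM lt (Spoly lt F p)) (schreyer_deg F p.2).
Proof.
move=> Sp nz; have := @bar_le_deg F (Spair_vector F p) (schreyer_deg F p.2) _
  (LM lt (Spoly lt F p)).
rewrite bar_Spair_vector mcoeff_msupp LC_neq0 // => /(_ _ isT)/predU1P[].
- by move=> t; apply: module_LM_deg; apply: module_LM_Spair_vector.
- move=> eq_deg; have := LC_neq0 hlt nz; rewrite /LC eq_deg.
  rewrite mcoeffB !mcoeffZ mcoeffXM_schreyer_deg.
  have [_ eqd] := Sp; rewrite /schreyer_deg -eqd mcoeffXM_schreyer_deg.
  by rewrite !mulVf ?LC_neq0 // subrr eqxx.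
- by [].
Qed.

(** A standard representation of the S-polynomial uses only monomials of degree strictly below that
    of [p.2], so the guessed signature is not minimal. *)
Lemma groebner_guess p :
  groebner_basis lt F -> is_Spair lt F p -> guess_not_signature lt F p.
Proof.
move=> gb Sp; have [|nz] := eqVneq (Spoly lt F p) 0; [by left|right].
case=> _ min_sig.
have [|u bar_u le_u] := groebner_standard_repr gb _ nz.
  by apply/ideal_ofP; exists (Spair_vector F p); rewrite bar_Spair_vector.
have [|t LMu] := @module_LM_exists F u.
  by apply: contraNneq nz => u0; rewrite -bar_u u0 bar_mulmx mul0mx mxE.
have lt_t : lt (schreyer_deg F t) (schreyer_deg F p.2).
  by apply: (tle_lt_trans hlt) (Spoly_LM_lt Sp nz); apply: le_u; case: LMu.
have /negP[] := tltNle hlt lt_t; rewrite /guessed_signature in min_sig.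
by case: (min_sig u t bar_u LMu) => [->|/schreyer_lt_deg //]; rewrite eqxx.
Qed.

Lemma guess_not_signature_Syz p : is_Spair lt F p -> guess_not_signature lt F p ->
  module_LM_set lt F (Syz F) p.2.
Proof.
move=> Sp; have LMp := module_LM_Spair_vector hF Sp.
case=> [S0|not_sig].
  exists (Spair_vector F p); split=> //; last exact: module_LM_neq0 LMp.
  by rewrite /Syz bar_Spair_vector.
(* Since [Spair_vector F p] already represents the S-polynomial with leading monomial [p.2], only
   minimality can fail. *)
have [u [t [bar_u LMu lt_t]]] : exists u t,
    [/\ bar F u = Spoly lt F p, is_module_LM lt F u t & schreyer_lt lt F t p.2].
  apply: NNPP => min_p; apply: not_sig; split.
    by exists (Spair_vector F p); rewrite ?bar_Spair_vector.
  move=> u t bar_u LMu.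
  have [eq_t|lt_t|lt_t] := schreyer_total F p.2 t; [by left|by right|].
  by case: min_p; exists u, t.
have LMw := module_LM_sub LMp LMu lt_t.
exists (Spair_vector F p - u); split=> //; last exact: module_LM_neq0 LMw.
by rewrite /Syz barB bar_Spair_vector bar_u subrr.
Qed.

(** Every guessed signature is a monomial multiple of a standard one, and multiplying a syzygy by
    that monomial shifts its leading monomial accordingly. *)
Lemma standard_guess_LM_Syz :
  (forall p, standard_Spair lt F p -> guess_not_signature lt F p) ->
  forall s, module_LM_set lt F (Syz F) s <-> module_LM_set lt F (Syz (LMF lt F)) s.
Proof.
move=> guess s; split=> [/(Syz_leading hF) ?|]; first exact/Syz_LMF_leading.
case/Syz_LMF_leading=> t /Spair_standard[c [p [std ->]]].
have [u [syz_u _ LMu]] := guess_not_signature_Syz std.1 (guess p std).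
have LMw := module_LM_shift c LMu.
exists ('X_[c] *: u); split=> //; last exact: module_LM_neq0 LMw.
by rewrite /Syz barZ syz_u mulr0.
Qed.

Lemma LM_Syz_signature :
  (forall s, module_LM_set lt F (Syz F) s <-> module_LM_set lt F (Syz (LMF lt F)) s) ->
  forall f, ideal_of F f -> f != 0 ->
    exists2 s, is_signature lt F f s & LM lt (bar F (mmon K s)) = LM lt f.
Proof.
move=> LM_Syz f /ideal_ofP[u0 bar_u0] nz; have [s sig] := signature_exists nz bar_u0.
exists s => //; rewrite LM_bar_mmon //; have [[u bar_u LMu] min_s] := sig.
apply/esym/LM_unique => //; last first.
  by rewrite -bar_u; apply: bar_le_deg => t; apply: module_LM_deg.
apply/eqP=> top0; rewrite -bar_u in top0.
(* Cancellation makes [s] a guessed signature, hence the leading monomial of a syzygy [v] of [F]. *)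
have /Syz_LMF_leading/LM_Syz[v [syz_v _ [vs max_v]]] := leading_cancellation hF LMu top0.
have [us max_u] := LMu.
(* The scalar kills the coefficient at [s]; [w] still represents [f], with a leading monomial below
   [s], against minimality. *)
pose w := u - ((u 0 s.2)@_s.1 / (v 0 s.2)@_s.1)%:MP *: v.
have bar_w : bar F w = f by rewrite barB barZ syz_v mulr0 subr0.
have [|t LMw] := @module_LM_exists F w.
  by apply: contraNneq nz => w0; rewrite -bar_w w0 bar_mulmx mul0mx mxE.
have lt_ts : schreyer_lt lt F t s.
  have [wt _] := LMw.
  have t_neq : t <> s.
    move=> eq_ts; move: wt; rewrite eq_ts !mxE mcoeffB mcoeffCM divfK //.
    by rewrite subrr eqxx.
  move: wt; rewrite !mxE mcoeffB mcoeffCM.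
  have [->|/max_u[//|//]] := eqVneq (u 0 t.2)@_t.1 0.
  rewrite sub0r oppr_eq0 mulf_eq0 negb_or => /andP[_ /max_v[//|//]].
have [eq_st|lt_st] := min_s w t bar_w LMw; first by rewrite eq_st schreyer_irr in lt_ts.
by have := schreyer_trans lt_ts lt_st; rewrite schreyer_irr.
Qed.

(** By (e), [LM(f)] is the degree of a module monomial, hence a multiple of some [LM(f_i)]; the
    other inclusion holds because each [f_i] lies in the ideal. *)
Lemma signature_groebner :
  (forall f, ideal_of F f -> f != 0 ->
    exists2 s, is_signature lt F f s & LM lt (bar F (mmon K s)) = LM lt f) ->
  groebner_basis lt F.
Proof.
move=> sig g; split.
  move=> Ig; apply/ideal_ofP; apply: ideal_gen_bar Ig => _ [f [If nz ->]].
  have [s _ <-] := sig f If nz; exists (mmon K s).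
  by rewrite LM_bar_mmon // bar_mmon -mpolyXD.
move=> [k [c [h [hh ->]]]]; exists k, c, h; split=> // i; have [j ->] := hh i.
exists (F j); split=> //; apply/ideal_ofP; exists (delta_mx 0 j); exact: bar_delta.
Qed.

End Equivalences.

End Schreyer.

(** * The cycle of implications from (a) through (e) back to (a) *)

Theorem theorem3p5 (K : fieldType) (n m : nat) (lt : rel 'X_{1..n})
    (hlt : term_order lt) (F : 'I_m -> {mpoly K[n]})
    (hF : forall i, F i != 0) :
  [<-> groebner_basis lt F;
       forall p, is_Spair lt F p -> guess_not_signature lt F p;
       forall p, standard_Spair lt F p -> guess_not_signature lt F p;
       forall s, module_LM_set lt F (Syz F) s <->
                 module_LM_set lt F (Syz (LMF lt F)) s;
       forall f, ideal_of F f -> f != 0 ->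
         exists2 s, is_signature lt F f s &
                    LM lt (bar F (mmon K s)) = LM lt f].
Proof.
tfae.
- by move=> gb p; apply: groebner_guess.
- by move=> guess p [Sp _]; apply: guess.
- exact: standard_guess_LM_Syz.
- exact: LM_Syz_signature.
- exact: signature_groebner.
Qed.
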